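(* There is an absolute constant $c>0$ such that for all integers $d\ge 2$ and $2\le \ell\le k$, $$\frac{1}{k}\left(\frac{d^k}{e\,d^{\ell-1}k}\right)^{1+\frac{1}{\ell-1}}\;\le\; m_\ell(k,d)\;<\;c\left(k^2\ell^{-1}\ln(d)\,d^k\right)^{1+\frac{1}{\ell-1}},$$ where $m_\ell(k,d)$ denotes the largest integer $m$ such that every $\ell$-disjoint $(k,d)$-CSP with at most $m$ constraints is satisfiable.
   Context: Variables take values in $\{0,1,\dots,d-1\}$. A literal is an expression $x\neq b$ with $x$ a variable and $b\in\{0,\dots,d-1\}$. A $k$-constraint is a set of $k$ literals involving $k$ distinct variables; a $(k,d)$-CSP is a finite set of $k$-constraints. An assignment $\alpha$ (a map from variables to $\{0,\dots,d-1\}$) satisfies the literal $x\ne b$ if $\alpha(x)\ne b$, satisfies a constraint if it satisfies at least one of its literals, and satisfies a CSP if it satisfies all its constraints; a CSP is satisfiable if some assignment satisfies it. For a constraint $C$, $\mathrm{vbl}(C)$ is the set of variables occurring in $C$. A CSP $F$ is $\ell$-disjoint if there are no two distinct constraints $C,D\in F$ with $|\mathrm{vbl}(C)\cap\mathrm{vbl}(D)|\ge \ell$. *)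

(* Defs.v *)
From mathcomp Require Import all_boot.

Set Implicit Arguments.
Unset Strict Implicit.
Unset Printing Implicit Defensive.

Section CSP.
Variables (V : finType) (d : nat).

(* The pair (x, b) stands for the literal "x <> b". *)
Definition literal : Type := (V * 'I_d)%type.

Definition assignment : Type := {ffun V -> 'I_d}.

Definition constraint : Type := {set V * 'I_d}.

Definition csp : Type := {set {set V * 'I_d}}.

Definition sat_literal (a : assignment) (u : literal) : bool := a u.1 != u.2.

Definition sat_constraint (a : assignment) (C : constraint) : bool :=
  [exists u in C, sat_literal a u].

Definition sat_csp (a : assignment) (F : csp) : bool :=
  [forall C in F, sat_constraint a C].

Definition satisfiable (F : csp) : Prop := exists a : assignment, sat_csp a F.

Definition vbl (C : constraint) : {set V} := [set u.1 | u in C].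

Definition is_kconstraint (k : nat) (C : constraint) : bool :=
  (#|C| == k) && (#|vbl C| == k).

Definition is_kcsp (k : nat) (F : csp) : bool :=
  [forall C in F, is_kconstraint k C].

Definition ldisjoint (l : nat) (F : csp) : Prop :=
  ~ exists C D : constraint,
      [/\ C \in F, D \in F, C != D & l <= #|vbl C :&: vbl D|].

End CSP.

(* A finite CSP mentions finitely many variables, so the variable set ranges
   over all finite types. *)
Definition all_satisfiable (l k d m : nat) : Prop :=
  forall (V : finType) (F : csp V d),
    is_kcsp k F -> ldisjoint l F -> #|F| <= m -> satisfiable F.

(* m = m_l(k,d), the largest m for which all_satisfiable l k d m holds.  As
   m = 0 qualifies for 0 < d, the largest such integer is a natural number. *)
Definition is_max_satisfiable (l k d m : nat) : Prop :=
  all_satisfiable l k d m /\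
  forall m' : nat, all_satisfiable l k d m' -> m' <= m.

(* Main.v *)
(* Lower bound: keep in every constraint its k - l + 1 least frequent variables.
   If each variable is kept at most t times, with e k t <= d^(k-l+1), the local
   lemma satisfies the shortened constraints. Otherwise some x is kept more than
   t times, and the l - 1 variables dropped from each of these constraints are
   at least as frequent as x; by l-disjointness the dropped sets are distinct,
   so about t^(1/(l-1)) variables occur more than t times each.
   Upper bound: let the variables be the points of a k x q grid and the
   variable sets of the constraints the graphs of a Gilbert-Varshamov family of
   functions pairwise agreeing in fewer than l places. Choosing literals
   greedily, each constraint kills a fraction d^-k of the assignments left, so
   slightly more than k q ln(d) d^k constraints kill all of them. *)
Require Import Defs.
From mathcomp Require Import all_boot all_order all_algebra.
From mathcomp Require Import zify ring lra.
From mathcomp Require Import boolp reals sequences exp.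
Import Order.TTheory GRing.Theory Num.Theory.

Set Implicit Arguments.
Unset Strict Implicit.
Unset Printing Implicit Defensive.

Local Open Scope nat_scope.

(** * Union bound and counts of violating assignments *)

Lemma leq_card_bigcup (I T : finType) (P : pred I) (F : I -> {set T}) :
  #|\bigcup_(i | P i) F i| <= \sum_(i | P i) #|F i|.
Proof.
elim/big_rec2: _ => [|i m A _ IH]; first by rewrite cards0.
by apply: leq_trans (leq_card_setU _ _) _; rewrite leq_add2l.
Qed.

Lemma unsatP {V : finType} {d : nat} (a : assignment V d) (C : constraint V d) :
  reflect (forall u, u \in C -> a u.1 = u.2) (~~ sat_constraint a C).
Proof.
rewrite negb_exists; apply: (iffP forallP) => [H u uC|H u].
  by have := H u; rewrite uC /= /sat_literal negbK => /eqP.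
by apply/nandP; case uC: (u \in C); [right; rewrite negbK; apply/eqP/H|left].
Qed.

(* An assignment violating C and free values on vbl C together determine an
   assignment; this is the independence needed in the local lemma. *)
Lemma card_unsat_indep (V : finType) (d r : nat) (C : constraint V d)
    (P : pred (assignment V d)) :
    0 < d -> is_kconstraint r C ->
    (forall a b : assignment V d, (forall x, x \notin vbl C -> a x = b x) ->
      P a -> P b) ->
  #|[set a | P a & ~~ sat_constraint a C]| * d ^ r <= #|[set a | P a]|.
Proof.
move=> d0 /andP[_ /eqP Cr] Pext.
pose y0 := Ordinal d0.
pose G := [set g : assignment V d | g \in pffun_on y0 (vbl C) predT].
have cG : #|G| = d ^ r by rewrite cardsE card_pffun_on Cr cardT size_enum_ord.
rewrite -cG -cardsX.
pose h (p : assignment V d * assignment V d) : assignment V d :=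
  [ffun x => if x \in vbl C then p.2 x else p.1 x].
rewrite -(card_in_imset (f := h)).
  apply/subset_leq_card/subsetP => b /imsetP[[a g]].
  rewrite !inE => /= /andP[/andP[Pa _] _] ->.
  apply: (Pext a) Pa => x xC; rewrite ffunE (negPf xC) //.
move=> [a g] [b g']; rewrite !inE /= => /andP[/andP[_ /unsatP Ha]
  /pffun_onP[/subsetP gs _]] /andP[/andP[_ /unsatP Hb] /pffun_onP[/subsetP gs' _]] /ffunP e.
congr pair; apply/ffunP => x; have := e x; rewrite !ffunE /=; case: ifPn => // xC.
- by move=> _; case/imsetP: xC => u uC ->; rewrite Ha // Hb.
- move=> _; have /contraNeq := gs x; have /contraNeq := gs' x.
  by move=> -> // ->.
Qed.

Lemma card_unsat (V : finType) (d r : nat) (C : constraint V d) :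
    0 < d -> is_kconstraint r C ->
  #|[set a | ~~ sat_constraint a C]| * d ^ r <= d ^ #|V|.
Proof.
move=> d0 kC; have := @card_unsat_indep V d r C predT d0 kC (fun _ _ _ _ => isT).
have -> : #|[set a : assignment V d | predT a]| = d ^ #|V|.
  by rewrite cardsE card_ffun card_ord.
by congr (_ * _ <= _); apply: eq_card => a; rewrite !inE.
Qed.

(** Union bound: a constraint excludes at most a fraction [d^-k] of the assignments, and all must be
    excluded. *)
Lemma unsat_card_ge (V : finType) (d k : nat) (F : csp V d) :
    0 < d -> is_kcsp k F -> ~ satisfiable F -> d ^ k <= #|F|.
Proof.
move=> d0 /forall_inP kF unF.
have cover : d ^ #|V| <= \sum_(C in F) #|[set a | ~~ sat_constraint a C]|.
  have -> : d ^ #|V| = #|[set: assignment V d]| by rewrite cardsT card_ffun card_ord.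
  apply: leq_trans (leq_card_bigcup _ _).
  apply/subset_leq_card/subsetP => a _.
  have : ~~ sat_csp a F by apply/negP => ha; apply: unF; exists a.
  by rewrite negb_forall => /existsP[C]; rewrite negb_imply => /andP[CF ha];
    apply/bigcupP; exists C; rewrite ?inE.
rewrite -(@leq_pmul2l (d ^ #|V|)) ?expn_gt0 ?d0 //.
apply: leq_trans (leq_mul cover (leqnn _)) _.
rewrite big_distrl /= mulnC -sum_nat_const.
by apply: leq_sum => C CF; apply: card_unsat (kF _ CF).
Qed.

(** Greedy: keep adding an element of least weight among those left. A constant weight just gives a
    subset of prescribed size. *)
Lemma exists_lightest {T : finType} (w : T -> nat) (A : {set T}) (r : nat) :
    r <= #|A| ->
  exists B : {set T}, [/\ B \subset A, #|B| = r &
    forall x y, x \in B -> y \in A :\: B -> w x <= w y].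
Proof.
elim: r => [|r IH] rA.
  by exists set0; split=> [||x y]; rewrite ?sub0set ?cards0 ?inE.
have [B [BA Br Bw]] := IH (ltnW rA).
have /card_gt0P[z0 z0AB] : 0 < #|A :\: B|.
  by rewrite cardsD (setIidPr BA) Br subn_gt0.
case: (arg_minnP (P := fun y => y \in A :\: B) w z0AB) => z /= zAB zmin.
move: (zAB); rewrite !inE => /andP[zB zA].
exists (z |: B); split=> [||x y].
- by rewrite subUset sub1set zA.
- by rewrite cardsU1 zB Br.
- rewrite !inE negb_or => /orP[/eqP->|xB] /andP[/andP[yz yB] yA].
    by apply: zmin; rewrite !inE yB.
  by apply: Bw => //; rewrite !inE yB.
Qed.

(** * The symmetric local lemma *)

Section LocalLemma.
Local Open Scope ring_scope.
Variables (R : realType) (V I : finType) (d : nat) (C : I -> constraint V d).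

(** Counts replace probabilities: ratios of values of [nsat] are conditional probabilities. *)
Let nsat (S : {set I}) : R :=
  #|[set a | [forall j in S, sat_constraint a (C j)]]|%:R.

Let nsat_sub (S T : {set I}) : S \subset T -> nsat T <= nsat S.
Proof.
move=> /subsetP ST; rewrite ler_nat; apply/subset_leq_card/subsetP => a.
by rewrite !inE => /forall_inP H; apply/forall_inP => j /ST; apply: H.
Qed.

(** Chain rule: the elements of [T] are added one at a time, each at the cost of a factor [x]. *)
Let nsat_chain (x : R) (m : nat) : 0 <= x ->
    (forall (S : {set I}) i, (#|S| < m)%N -> i \notin S ->
      x * nsat S <= nsat (i |: S)) ->
  forall T S : {set I}, [disjoint T & S] -> (#|T :|: S| <= m)%N ->
    x ^+ #|T| * nsat S <= nsat (T :|: S).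
Proof.
move=> x0 IH T; move: {2}#|T| (erefl #|T|) => t; elim: t T => [|t IHt] T cT S TS Tm.
  by rewrite cT expr0 mul1r (cards0_eq cT) set0U.
have /card_gt0P[i iT] : (0 < #|T|)%N by rewrite cT.
have cT' : #|T :\ i| = t by move: cT; rewrite (cardsD1 i) iT => -[].
have e : T :|: S = i |: (T :\ i :|: S) by rewrite setUA setD1K.
have iS : i \notin T :\ i :|: S by rewrite !inE eqxx /= (disjointFr TS).
rewrite e; apply: le_trans (IH _ _ _ iS); last first.
  by move: Tm; rewrite e cardsU1 iS.
rewrite cT exprS -mulrA ler_wpM2l // -cT'; apply: IHt => //.
  by apply: disjointWl TS; apply: subsetDl.
by apply: leq_trans Tm; apply: subset_leq_card; rewrite setSU ?subsetDl.
Qed.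

(** With [N = n - 1], [1 - 1/n] is the inverse of [1 + 1/N], which is at most [expR (1/N)]. *)
Let expR_inv_le (n : nat) : (1 < n)%N -> (expR 1)^-1 <= (1 - n%:R^-1) ^+ n.-1 :> R.
Proof.
case: n => [//|[//|n]] _ /=; set N := n.+1.
have N0 : 0 < N%:R :> R by rewrite ltr0n.
have -> : 1 - N.+1%:R^-1 = (1 + N%:R^-1)^-1 :> R.
  rewrite -natr1 -[in RHS](divff (lt0r_neq0 N0)).
  field; rewrite -?natrD; lra.
rewrite exprVn lef_pV2 ?posrE ?expR_gt0 ?exprn_gt0 ?addr_gt0 ?invr_gt0 //.
have -> : expR 1 = expR (N%:R^-1) ^+ N :> R.
  by rewrite -expRM_natr mulVf ?lt0r_neq0.
by apply: lerXn2r; rewrite ?nnegrE ?expR_ge0 ?expR_ge1Dx ?addr_ge0 ?invr_ge0 ?ltW.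
Qed.

(** The usual condition [e p (D + 1) <= 1], with [p = d^-r] and [D < n]. The constraints form an
    indexed family, since distinct constraints may have equal shortenings. By induction on [#|S|], a
    fraction at least [1 - 1/n] of the assignments satisfying [S] also satisfies [C i]. *)
Lemma local_lemma (n r : nat) : (0 < d)%N -> (1 < n)%N ->
    (forall i, is_kconstraint r (C i)) ->
    (forall i, #|[set j | (j != i) && ~~ [disjoint vbl (C j) & vbl (C i)]]| < n)%N ->
    expR 1 * n%:R <= d%:R ^+ r :> R ->
  exists a, forall i, sat_constraint a (C i).
Proof.
move=> d0 n1 kC degC hn.
have n0 : 0 < n%:R :> R by rewrite ltr0n ltnW.
have nV : n%:R^-1 < 1 :> R by rewrite invf_lt1 // ltr1n.
set x : R := 1 - n%:R^-1.
have x0 : 0 < x by rewrite subr_gt0.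
have x1 : x <= 1 by rewrite gerBl invr_ge0 ltW.
have step : forall m (S : {set I}) i, (#|S| < m)%N -> i \notin S ->
    x * nsat S <= nsat (i |: S).
  elim=> [//|m IH] S i Sm iS.
  (* [G] collects the neighbours of [i]; violating [C i] is independent of the rest of [S]. *)
  pose G := [set j in S | ~~ [disjoint vbl (C j) & vbl (C i)]].
  have Gn : (#|G| <= n.-1)%N.
    rewrite -ltnS prednK ?(ltnW n1) //; apply: leq_ltn_trans (degC i).
    apply/subset_leq_card/subsetP => j; rewrite !inE => /andP[jS ->].
    by rewrite andbT; apply: contraNneq iS => <-.
  have GS : G \subset S by apply/subsetP => j; rewrite inE => /andP[].
  have SG : G :|: (S :\: G) = S.
    by apply/setP => j; rewrite !inE; case: (j \in S); case: [disjoint _ & _].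
  have disGS : [disjoint G & S :\: G].
    by rewrite -setI_eq0; apply/eqP/setP => j; rewrite !inE; case: (j \in S); case: [disjoint _ & _].
  (* Adding [G] back to [S :\: G] conditions only on sets smaller than [S], so the induction
     hypothesis applies at most [n - 1] times. *)
  have chain : (expR 1)^-1 * nsat (S :\: G) <= nsat S.
    apply: (@le_trans _ _ (x ^+ #|G| * nsat (S :\: G))).
      rewrite ler_wpM2r ?ler0n //.
      by apply: le_trans (expR_inv_le n1) _; apply: ler_wiXn2l; rewrite ?(ltW x0).
    rewrite -[in leRHS]SG; apply: (nsat_chain (ltW x0) IH) => //.
    by rewrite SG -ltnS.
  pose P (a : assignment V d) := [forall j in S, sat_constraint a (C j)].
  pose Q (a : assignment V d) := [forall j in S :\: G, sat_constraint a (C j)].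
  set B := [set a | P a & ~~ sat_constraint a (C i)].
  have split : nsat S = nsat (i |: S) + #|B|%:R.
    rewrite /nsat -natrD; congr (_%:R).
    rewrite -(cardsID [set a | sat_constraint a (C i)]); congr (_ + _)%N.
      apply: eq_card => a; rewrite !inE; apply/andP/forall_inP => [[/forall_inP H hi] j|H].
        by rewrite !inE => /orP[/eqP->//|]; apply: H.
      split; last by apply: H; rewrite setU11.
      by apply/forall_inP => j jS; apply: H; rewrite setU1r.
    by apply: eq_card => a; rewrite !inE andbC.
  have indep : #|B|%:R * d%:R ^+ r <= nsat (S :\: G).
    rewrite -natrX -natrM ler_nat.
    apply: leq_trans (@card_unsat_indep V d r (C i) Q d0 (kC i) _).
      rewrite leq_mul2r; apply/orP; right.
      apply/subset_leq_card/subsetP => a; rewrite !inE => /andP[/forall_inP H ->].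
      by rewrite andbT; apply/forall_inP => j; rewrite inE => /andP[_]; apply: H.
    move=> a b ab /forall_inP H; apply/forall_inP => j jSG.
    have /existsP[u /andP[uC hu]] := H j jSG.
    apply/existsP; exists u; rewrite uC /= /sat_literal -ab //.
    move: jSG; rewrite !inE negb_and => /andP[/orP[/negPf->//|]]; rewrite negbK => dis _.
    by rewrite (disjointFr dis) //; apply: imset_f.
  (* The factor [e] lost in [chain] is the one in the hypothesis: at most a fraction [1/n] of the
     assignments satisfying [S] violates [C i]. *)
  have B1 : #|B|%:R * n%:R <= nsat S.
    apply: le_trans chain; rewrite -ler_pdivrMl ?invr_gt0 ?expR_gt0 // invrK.
    by apply: le_trans indep; rewrite mulrCA ler_wpM2l ?ler0n.
  rewrite /x mulrBl mul1r lerBlDr {1}split lerD2l -ler_pdivrMl ?invr_gt0 //.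
  by rewrite invrK mulrC.
have pos : 0 < nsat setT.
  rewrite -[setT]setU0; apply: lt_le_trans (_ : 0 < x ^+ #|[set: I]| * nsat set0) _.
    rewrite mulr_gt0 ?exprn_gt0 // ltr0n; apply/card_gt0P.
    exists [ffun => Ordinal d0]; rewrite inE; apply/forall_inP => j.
    by rewrite inE.
  apply: (nsat_chain (m := #|I|) (ltW x0)) => [S i _||]; first exact: step (ltnSn _).
    by rewrite -setI_eq0 setI0.
  by rewrite max_card.
move: pos; rewrite ltr0n => /card_gt0P[a]; rewrite inE => /forall_inP H.
by exists a => i; apply: H.
Qed.

End LocalLemma.

(** * Degrees and frequent variables *)

Lemma ffact_leq_exp (n m : nat) : n ^_ m <= n ^ m.
Proof. by elim: m => // m IH; rewrite ffactnSr expnSr leq_mul ?leq_subr. Qed.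

Lemma bin_leq_exp (n m : nat) : 'C(n, m) <= n ^ m.
Proof.
apply: leq_trans (ffact_leq_exp n m).
by rewrite -bin_ffact leq_pmulr ?fact_gt0.
Qed.

Lemma kconstraint_inj (V : finType) (d k : nat) (C : constraint V d) :
  is_kconstraint k C -> {in C &, injective fst}.
Proof. by case/andP => /eqP Ck vk; apply/imset_injP; rewrite Ck. Qed.

Lemma sub_kconstraint (V : finType) (d k : nat) (C B : constraint V d) :
  is_kconstraint k C -> B \subset C -> is_kconstraint #|B| B.
Proof.
move=> kC /subsetP BC; rewrite /is_kconstraint eqxx /=; apply/imset_injP.
by move=> u v /BC uC /BC vC; apply: (kconstraint_inj kC).
Qed.

Lemma card_vbl (V : finType) (d k : nat) (C B : constraint V d) :
  is_kconstraint k C -> B \subset C -> #|vbl B| = #|B|.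
Proof. by move=> kC /(sub_kconstraint kC) /andP[_ /eqP]. Qed.

Definition degree (V : finType) (d : nat) (F : csp V d) (x : V) : nat :=
  #|[set C in F | x \in vbl C]|.

(** Double counting of incidences. *)
Lemma sum_degree (V : finType) (d k : nat) (F : csp V d) :
  is_kcsp k F -> \sum_x degree F x = k * #|F|.
Proof.
move=> /forall_inP kF.
transitivity (\sum_x \sum_(C in F | x \in vbl C) 1).
  by apply: eq_bigr => x _; rewrite sum1dep_card.
rewrite (exchange_big_dep (mem F)) /=; last by move=> x C _ /andP[].
rewrite mulnC -sum_nat_const; apply: eq_bigr => C CF.
have /andP[_ /eqP <-] := kF C CF; rewrite -sum1_card.
by apply: eq_bigl => x; rewrite CF.
Qed.

(** Here [h + 1] is the number of variables of degree above [t]: one of them is kept more than [t]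
    times, and the sets dropped from those constraints are distinct [(l-1)]-subsets of the other
    [h]. *)
Lemma frequent_variables (R : realType) (V : finType) (d k l t : nat)
    (F : csp V d) :
    0 < d -> 1 < l <= k -> 0 < t -> is_kcsp k F -> ldisjoint l F ->
    ~ satisfiable F ->
    (expR 1 * (k * t)%:R <= d%:R ^+ (k - l).+1 :> R)%R ->
  exists h, t < h ^ l.-1 /\ h.+1 * t.+1 <= k * #|F|.
Proof.
move=> d0 /andP[l1 lk] t0 kF lF unF small.
have kFP C : C \in F -> is_kconstraint k C by move: C; apply/forall_inP.
have rk : (k - l).+1 <= k by lia.
(* [B C] is the shortened constraint. *)
have /choice[B HB] : forall C : constraint V d, exists B : constraint V d,
    C \in F -> [/\ B \subset C, #|B| = (k - l).+1 &
      forall u v, u \in B -> v \in C :\: B -> degree F u.1 <= degree F v.1].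
  move=> C; case CF : (C \in F); last by exists set0.
  have rC : (k - l).+1 <= #|C| by have /andP[/eqP -> _] := kFP C CF.
  by have [B HB] := exists_lightest (fun u => degree F u.1) rC; exists B.
have [/existsP[x xt]|/existsPn noheavy] :=
  boolP [exists x, t < #|[set C in F | x \in vbl (B C)]|]; last first.
  case: unF.
  pose I := {C : constraint V d | C \in F}.
  have [|i|i||a Ha] := @local_lemma R V I d (fun i => B (val i)) (k * t)
      (k - l).+1 d0.
  - nia.
  - have [BC Br _] := HB _ (valP i).
    by rewrite -Br; apply: sub_kconstraint BC; apply: kFP (valP i).
  - have [BC Br _] := HB _ (valP i).
    have kB := sub_kconstraint (kFP _ (valP i)) BC.
    have vB : #|vbl (B (val i))| = (k - l).+1 by rewrite -Br; case/andP: kB => _ /eqP.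
    rewrite -(card_imset _ val_inj).
    (* The union also contains the constraint itself, which is not its own neighbour; hence the
       strict inequality. *)
    apply: (@leq_trans #|\bigcup_(x in vbl (B (val i))) [set C in F | x \in vbl (B C)]|).
      apply/proper_card/properP; split.
        apply/subsetP => C /imsetP[j]; rewrite inE => /andP[_ /pred0Pn[x /andP[/= xj xi]]] ->.
        by apply/bigcupP; exists x; rewrite // inE (valP j).
      exists (val i).
        have /card_gt0P[x xi] : 0 < #|vbl (B (val i))| by rewrite vB.
        by apply/bigcupP; exists x; rewrite // inE (valP i).
      by apply/imsetP => -[j]; rewrite inE => /andP[/eqP ji _] /val_inj/esym.
    apply: leq_trans (leq_card_bigcup _ _) _.
    apply: leq_trans (_ : \sum_(x in vbl (B (val i))) t <= _).
      by apply: leq_sum => x _; have := noheavy x; rewrite -leqNgt.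
    by rewrite sum_nat_const vB leq_mul2r rk orbT.
  - exact: small.
  - exists a; apply/forall_inP => C CF.
    have [/subsetP BC _ _] := HB C CF.
    have /existsP[u /andP[/BC uC hu]] := Ha (exist _ C CF).
    by apply/existsP; exists u; rewrite uC.
set S := [set C in F | x \in vbl (B C)] in xt.
pose H := [set y | t < degree F y].
have SF C : C \in S -> C \in F by rewrite inE => /andP[].
have xH : x \in H.
  rewrite inE; apply: leq_trans xt _; apply/subset_leq_card/subsetP => C.
  rewrite !inE => /andP[CF xB]; rewrite CF.
  by have [BC _ _] := HB C CF; apply: subsetP (imsetS _ BC) _ xB.
have xv C : C \in S -> exists2 v, v \in B C & x = v.1.
  by rewrite inE => /andP[_ /imsetP].
pose phi C := vbl (C :\: B C).
have xphi C : C \in S -> x \notin phi C.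
  move=> CS; have [v vB ->] := xv C CS; have [/subsetP BC _ _] := HB C (SF C CS).
  apply/imsetP => -[u]; rewrite inE => /andP[uB uC] vu.
  have e := kconstraint_inj (kFP C (SF C CS)) (BC v vB) uC vu.
  by rewrite -e vB in uB.
have cphi C : C \in S -> #|phi C| = l.-1.
  move=> CS; have CF := SF C CS; have [BC Br _] := HB C CF.
  rewrite (card_vbl (kFP C CF)) ?subsetDl // cardsD (setIidPr BC) Br.
  by have /andP[/eqP -> _] := kFP C CF; lia.
(* Constraints in [S] keep [x], so their dropped sets avoid it; [x] still counts in the degree sum,
   giving [h + 1]. *)
exists #|H :\ x|; split.
  apply: leq_trans xt _; apply: leq_trans (bin_leq_exp _ _).
  rewrite -cards_draws -(card_in_imset (f := phi)).
    apply/subset_leq_card/subsetP => A /imsetP[C CS ->].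
    rewrite inE (cphi C CS) eqxx andbT subsetD1 xphi // andbT.
    apply/subsetP => y /imsetP[u uCB ->]; rewrite inE.
    have [v vB e] := xv C CS; have [_ _ /(_ v u vB uCB)] := HB C (SF C CS).
    by apply: leq_trans; move: xH; rewrite inE -e.
  (* Equal dropped sets together with [x] would be [l] common variables. *)
  move=> C D CS DS e; apply/eqP/negPn/negP => CD; apply: lF.
  exists C, D; split; rewrite ?SF //.
  have -> : l = #|x |: phi C| by rewrite cardsU1 xphi // cphi //; lia.
  apply/subset_leq_card.
  have sub E : E \in S -> x |: phi E \subset vbl E.
    move=> ES; have [BE _ _] := HB E (SF E ES).
    rewrite subUset sub1set imsetS ?subsetDl // andbT.
    by have [v vB ->] := xv E ES; apply/imset_f/(subsetP BE).
  by rewrite subsetI sub // e sub.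
rewrite -(sum_degree kF); have <- : #|H| = #|H :\ x|.+1 by rewrite (cardsD1 x) xH.
rewrite -sum_nat_const [leqRHS](bigID (mem H)) /=.
apply: leq_trans (leq_addr _ _).
by apply: leq_sum => y; rewrite inE.
Qed.

(** * Codes of functions with few agreements *)

(** Such functions are determined outside [A]: resetting them on [A] is injective. *)
Lemma card_agree_on (k q : nat) (A : {set 'I_k}) (g : {ffun 'I_k -> 'I_q}) :
    0 < q ->
  #|[set f : {ffun 'I_k -> 'I_q} | [forall i in A, f i == g i]]| <= q ^ (k - #|A|).
Proof.
move=> q0; pose y0 := Ordinal q0.
pose h (f : {ffun 'I_k -> 'I_q}) := [ffun i => if i \in A then y0 else f i].
rewrite -(card_in_imset (f := h)); last first.
  move=> f f'; rewrite !inE => /forall_inP fA /forall_inP fA' /ffunP e.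
  apply/ffunP => i; have := e i; rewrite !ffunE; case: ifPn => // iA _.
  by rewrite (eqP (fA i iA)) (eqP (fA' i iA)).
have -> : k - #|A| = #|~: A| by rewrite [RHS]cardsCs setCK card_ord.
rewrite -[q in q ^ _]card_ord -(card_pffun_on y0).
apply/subset_leq_card/subsetP => f' /imsetP[f _ ->].
apply/pffun_onP; split => //; apply/subsetP => i.
by rewrite !inE ffunE; case: (i \in A); rewrite // eqxx.
Qed.

(* Gilbert-Varshamov: a maximal family of functions pairwise agreeing in fewer
   than l places covers everything by balls. *)
Lemma gilbert_varshamov (k l q : nat) : l <= k -> 0 < q ->
  exists E : {set {ffun 'I_k -> 'I_q}},
    (forall f g, f \in E -> g \in E -> f != g -> #|[set i | f i == g i]| < l) /\
    q ^ l <= #|E| * 'C(k, l).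
Proof.
move=> lk q0.
pose agree (f g : {ffun 'I_k -> 'I_q}) := [set i | f i == g i].
have agreeC f g : agree f g = agree g f by apply/setP => i; rewrite !inE eq_sym.
pose P (E : {set {ffun 'I_k -> 'I_q}}) :=
  [forall f in E, forall g in E, (f != g) ==> (#|agree f g| < l)].
have P0 : P set0 by apply/forall_inP => f; rewrite inE.
have [E /maxsetP[PE maxE]] := ex_maxset (ex_intro P _ P0).
have PEP f g : f \in E -> g \in E -> f != g -> #|agree f g| < l.
  by move: PE => /forall_inP H fE gE fg; move/forall_inP/(_ g gE)/implyP: (H f fE); apply.
exists E; split=> //.
pose ball g := [set f | l <= #|agree f g|].
have cover : [set: {ffun 'I_k -> 'I_q}] \subset \bigcup_(g in E) ball g.
  apply/subsetP => f _; apply/bigcupP; apply/exists_inP; apply: contraT => /exists_inPn far.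
  have farE g : g \in E -> #|agree f g| < l.
    by move=> gE; have := far g gE; rewrite inE ltnNge.
  (* A function outside all balls could be added to [E], so maximality puts it in [E]; yet it agrees
     with itself in [k >= l] places. *)
  have fE : f \in E.
    rewrite -(maxE (f |: E)) ?setU11 ?subsetUr //.
    apply/forall_inP => g1; rewrite inE => g1E.
    apply/forall_inP => g2; rewrite inE => g2E; apply/implyP => g12.
    move: g1E g2E g12; rewrite !inE => /orP[/eqP->|g1E] /orP[/eqP->|g2E] g12.
    - by rewrite eqxx in g12.
    - exact: farE.
    - by rewrite agreeC farE.
    - exact: PEP.
  have := farE f fE; have -> : agree f f = setT by apply/setP => i; rewrite !inE eqxx.
  by rewrite cardsT card_ord ltnNge lk.
have ballP g : #|ball g| <= 'C(k, l) * q ^ (k - l).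
  apply: (@leq_trans #|\bigcup_(A : {set 'I_k} | #|A| == l)
      [set f : {ffun 'I_k -> 'I_q} | [forall i in A, f i == g i]]|).
    apply/subset_leq_card/subsetP => f; rewrite inE => lf.
    have [B [BA Bl _]] := exists_lightest (fun=> 0) lf.
    apply/bigcupP; exists B; first exact/eqP.
    by rewrite inE; apply/forall_inP => i /(subsetP BA); rewrite inE.
  apply: leq_trans (leq_card_bigcup _ _) _.
  apply: leq_trans (_ : \sum_(A : {set 'I_k} | #|A| == l) q ^ (k - l) <= _).
    by apply: leq_sum => A /eqP <-; apply: card_agree_on.
  by rewrite sum_nat_cond_const card_draws card_ord.
have := leq_trans (subset_leq_card cover) (leq_card_bigcup _ _).
rewrite cardsT card_ffun !card_ord => H.
rewrite -(@leq_pmul2r (q ^ (k - l))) ?expn_gt0 ?q0 // -expnD subnKC // -mulnA.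
apply: leq_trans H _; rewrite -sum_nat_const.
by apply: leq_sum => g _; apply: ballP.
Qed.

(** * Greedy labelling of graphs in the grid *)

Section Labelling.
Variables (k q d : nat).
Hypothesis d0 : 0 < d.

(** The function [f] fixes the variables, as its graph; the label [b] fixes the forbidden pattern
    along it. *)
Definition forbid (f : {ffun 'I_k -> 'I_q}) (b : {ffun 'I_k -> 'I_d}) :
    constraint ('I_k * 'I_q)%type d :=
  [set ((i, f i), b i) | i : 'I_k].

Lemma vbl_forbid f b : vbl (forbid f b) = [set (i, f i) | i : 'I_k].
Proof. by rewrite /vbl /forbid -imset_comp. Qed.

Lemma forbid_kconstraint f b : is_kconstraint k (forbid f b).
Proof.
apply/andP; split; last rewrite vbl_forbid.
  by rewrite card_imset ?card_ord // => i j [].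
by rewrite card_imset ?card_ord // => i j [].
Qed.

Lemma unsat_forbid f b (a : assignment ('I_k * 'I_q)%type d) :
  ~~ sat_constraint a (forbid f b) = (b == [ffun i => a (i, f i)]).
Proof.
apply/unsatP/eqP => [H|-> u /imsetP[i _ ->]]; last by rewrite ffunE.
by apply/ffunP => i; rewrite ffunE (H ((i, f i), b i)) //; apply: imset_f.
Qed.

Lemma card_vbl_forbidI f b f' b' :
  #|vbl (forbid f b) :&: vbl (forbid f' b')| <= #|[set i | f i == f' i]|.
Proof.
rewrite !vbl_forbid; apply: leq_trans (leq_imset_card (fun i => (i, f i)) _).
apply/subset_leq_card/subsetP => _ /setIP[/imsetP[i _ ->] /imsetP[j _ [ij e]]].
by rewrite -ij in e; apply/imsetP; exists i; rewrite // inE e.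
Qed.

(* By averaging over the d ^ k labels of f. *)
Lemma exists_label f (S : {set assignment ('I_k * 'I_q)%type d}) :
  exists b, #|[set a in S | sat_constraint a (forbid f b)]| * d ^ k
              <= #|S| * (d ^ k - 1).
Proof.
have [/existsP[b Hb]|/existsPn none] :=
  boolP [exists b, #|S| <= #|[set a in S | ~~ sat_constraint a (forbid f b)]| * d ^ k].
  exists b; move: Hb; rewrite -(cardsID [set a | sat_constraint a (forbid f b)] S).
  have -> : S :&: [set a | sat_constraint a (forbid f b)]
      = [set a in S | sat_constraint a (forbid f b)].
    by apply/setP => a; rewrite !inE.
  have -> : S :\: [set a | sat_constraint a (forbid f b)]
      = [set a in S | ~~ sat_constraint a (forbid f b)].
    by apply/setP => a; rewrite !inE andbC.
  move: #|_| #|_| => x y; have : 0 < d ^ k by rewrite expn_gt0 d0.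
  by rewrite mulnBr; nia.
(* Each assignment violates exactly one label, the pattern it shows along the graph of [f]. *)
have total : \sum_b #|[set a in S | ~~ sat_constraint a (forbid f b)]| = #|S|.
  transitivity (\sum_b \sum_(a in S | b == [ffun i => a (i, f i)]) 1).
    by apply: eq_bigr => b _; rewrite sum1dep_card; apply: eq_card => a;
      rewrite !inE unsat_forbid.
  rewrite (exchange_big_dep (mem S)) /=; last by move=> b a _ /andP[].
  rewrite -sum1_card; apply: eq_bigr => a aS.
  by rewrite (eq_bigl (pred1 [ffun i => a (i, f i)])) ?big_pred1_eq // => b; rewrite aS.
exfalso.
(* Some label exists, which makes the summed inequality strict. *)
pose b0 : {ffun 'I_k -> 'I_d} := [ffun => Ordinal d0].
have : (\sum_b #|[set a in S | ~~ sat_constraint a (forbid f b)]|) * d ^ k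
    < \sum_(b : {ffun 'I_k -> 'I_d}) #|S|.
  rewrite big_distrl /= (bigD1 b0) //= [ltnRHS](bigD1 b0) //= -addSn leq_add //.
    by rewrite ltnNge none.
  by apply: leq_sum => b _; rewrite ltnW // ltnNge none.
by rewrite total sum_nat_const card_ffun !card_ord mulnC ltnn.
Qed.

(** Each label leaves at most a fraction [1 - d^-k] of the survivors, out of [d ^ (k * q)]
    assignments; denominators are cleared. *)
Lemma exists_labelling (s : seq {ffun 'I_k -> 'I_q}) : uniq s ->
  exists b : {ffun 'I_k -> 'I_q} -> {ffun 'I_k -> 'I_d},
    #|[set a | all (fun f => sat_constraint a (forbid f (b f))) s]| * d ^ (k * size s)
      <= d ^ (k * q) * (d ^ k - 1) ^ size s.
Proof.
elim: s => [_|f s IH] /=.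
  exists (fun=> [ffun => Ordinal d0]); rewrite muln0 !muln1.
  by rewrite cardsE cardT -cardE card_ffun card_prod !card_ord.
move=> /andP[fs /IH[b Hb]].
have [b1 Hb1] := exists_label f
  [set a | all (fun f => sat_constraint a (forbid f (b f))) s].
(* By [uniq], [f] is not in the tail, so earlier labels are unchanged. *)
exists (fun g => if g == f then b1 else b g).
have -> : [set a | sat_constraint a (forbid f (if f == f then b1 else b f)) &&
      all (fun g => sat_constraint a (forbid g (if g == f then b1 else b g))) s]
    = [set a in [set a | all (fun f => sat_constraint a (forbid f (b f))) s]
        | sat_constraint a (forbid f b1)].
  apply/setP => a; rewrite !inE eqxx andbC; congr andb.
  by apply: eq_in_all => g gs; case: eqP => // e; rewrite -e gs in fs.
rewrite mulnS expnD expnSr mulnA.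
apply: leq_trans (leq_mul Hb1 (leqnn _)) _.
by rewrite mulnAC mulnA leq_mul2r Hb orbT.
Qed.

End Labelling.

(** The numerical hypothesis leaves fewer than one survivor, hence none. *)
Lemma unsat_from_code (k q d l M : nat) (E : {set {ffun 'I_k -> 'I_q}}) :
    0 < d ->
    (forall f g, f \in E -> g \in E -> f != g -> #|[set i | f i == g i]| < l) ->
    M <= #|E| -> d ^ (k * q) * (d ^ k - 1) ^ M < d ^ (k * M) ->
  ~ all_satisfiable l k d M.
Proof.
move=> d0 codeE ME few /(_ ('I_k * 'I_q)%type) allsat.
have [E' [E'E E'M _]] := exists_lightest (fun=> 0) ME.
have [b] := exists_labelling d0 (enum_uniq E').
rewrite -cardE E'M; set S := [set a | _] => HS.
have S0 : S = set0.
  apply/eqP; rewrite -cards_eq0 -leqn0 leqNgt; apply/negP => Spos.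
  by have := leq_trans few (leq_trans (leq_pmull _ Spos) HS); rewrite ltnn.
have [|||a /forall_inP Ha] := allsat [set forbid f (b f) | f in E'].
- by apply/forall_inP => _ /imsetP[f _ ->]; apply: forbid_kconstraint.
- case=> _ [_] [/imsetP[f fE ->] /imsetP[g gE ->] fg].
  apply/negP; rewrite -ltnNge; apply: leq_ltn_trans (card_vbl_forbidI _ _ _ _) _.
  apply: codeE; rewrite ?(subsetP E'E) //.
  by apply: contraNneq fg => ->.
- by rewrite -E'M leq_imset_card.
have : a \in S.
  rewrite inE; apply/allP => f; rewrite mem_enum => fE.
  by apply/Ha/imset_f.
by rewrite S0 inE.
Qed.

Local Open Scope ring_scope.

(** * Real estimates *)

Section Bounds.
Variable R : realType.

(** Weak Stirling bound, by induction from [(1 + 1/n)^n <= e]. *)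
Lemma exprn_le_expR_fact (n : nat) : n%:R ^+ n <= expR 1 ^+ n * n`!%:R :> R.
Proof.
elim: n => [|n IH]; first by rewrite !expr0 mul1r.
have e : n.+1%:R ^+ n <= expR 1 * n%:R ^+ n :> R.
  case: n {IH} => [|n]; first by rewrite !expr0 mulr1 -[leLHS]expR0 ler_expR ler01.
  have n0 : 0 < n.+1%:R :> R by rewrite ltr0n.
  have -> : expR 1 = expR (n.+1%:R^-1) ^+ n.+1 :> R.
    by rewrite -expRM_natr mulVf ?lt0r_neq0.
  rewrite -exprMn; apply: lerXn2r; rewrite ?nnegrE ?mulr_ge0 ?expR_ge0 ?ler0n //.
  apply: le_trans (ler_wpM2r (ltW n0) (expR_ge1Dx _)).
  by rewrite mulrDl mul1r mulVf ?lt0r_neq0 // natr1.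
rewrite exprS factS natrM exprS.
apply: le_trans (ler_wpM2l _ e) _; first exact: ler0n.
rewrite [leRHS](_ : _ = n.+1%:R * (expR 1 * (expR 1 ^+ n * n`!%:R))); last by ring.
by rewrite !ler_wpM2l ?ler0n ?expR_ge0.
Qed.

Lemma bin_le_powR (k l : nat) : (0 < l)%N ->
  'C(k, l)%:R <= (expR 1 * k%:R / l%:R) ^+ l :> R.
Proof.
move=> l0; have lR : 0 < l%:R :> R by rewrite ltr0n.
have f0 : 0 < l`!%:R :> R by rewrite ltr0n fact_gt0.
have h1 : 'C(k, l)%:R * l`!%:R <= k%:R ^+ l :> R.
  by rewrite -natrM -natrX ler_nat bin_ffact ffact_leq_exp.
rewrite expr_div_n exprMn ler_pdivlMr ?exprn_gt0 //.
apply: le_trans (ler_wpM2l _ (exprn_le_expR_fact l)) _; first exact: ler0n.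
by rewrite mulrCA ler_wpM2l ?exprn_ge0 ?expR_ge0.
Qed.

Lemma powR_root (x : R) (n : nat) : (0 < n)%N -> 0 <= x ->
  (x ^+ n) `^ (n%:R^-1) = x.
Proof.
move=> n0 x0; rewrite -powR_mulrn // -powRrM divff ?powRr1 //.
by rewrite pnatr_eq0 -lt0n.
Qed.

Lemma root_powR (x : R) (n : nat) : (0 < n)%N -> 0 <= x ->
  (x `^ (n%:R^-1)) ^+ n = x.
Proof.
move=> n0 x0; rewrite -powR_mulrn ?powR_ge0 // -powRrM mulVf ?powRr1 //.
by rewrite pnatr_eq0 -lt0n.
Qed.

Lemma powR1D (x p : R) : 0 < x -> x `^ (1 + p) = x * x `^ p.
Proof.
by move=> x0; rewrite powRD ?(lt0r_neq0 x0) ?implybT // powRr1 // ltW.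
Qed.

Lemma powR1D_le_sqr (x p : R) : 1 <= x -> p <= 1 -> x `^ (1 + p) <= x ^+ 2.
Proof.
move=> x1 p1; rewrite -powR_mulrn ?(le_trans ler01) //.
by rewrite ler_powR // -[2%:R]/(1 + 1) lerD2l.
Qed.

Lemma natr_predn (l : nat) : (1 < l)%N -> l%:R - 1 = l.-1%:R :> R.
Proof. by case: l => // l _; rewrite -natr1 addrK. Qed.

Lemma invr_predn_le1 (l : nat) : (1 < l)%N -> l.-1%:R^-1 <= 1 :> R.
Proof. by case: l => [|[|l]] // _; rewrite invf_le1 ?ltr0n // ler1n. Qed.

(** * Size of an unsatisfiable CSP from below *)

Lemma unsat_lower_bound (d l k : nat) (V : finType) (F : csp V d) :
    (2 <= d)%N -> (2 <= l)%N -> (l <= k)%N ->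
    is_kcsp k F -> ldisjoint l F -> ~ satisfiable F ->
  k%:R^-1 * ((d%:R ^+ k / (expR 1 * d%:R ^+ l.-1 * k%:R)) `^ (1 + (l%:R - 1)^-1))
    + 1 <= #|F|%:R :> R.
Proof.
move=> d2 l2 lk kF lF unF.
have d0 : (0 < d)%N by apply: ltnW.
have dR : 0 < d%:R :> R by rewrite ltr0n.
have k0 : (0 < k)%N by apply: leq_trans lk; apply: ltnW.
have kR : 0 < k%:R :> R by rewrite ltr0n.
have k1 : 1 <= k%:R :> R by rewrite ler1n.
have l0 : (0 < l.-1)%N by case: l l2 {lk lF} => [|[]].
rewrite natr_predn //; set p := l.-1%:R^-1.
have p0 : 0 <= p by rewrite invr_ge0 ler0n.
have p1 : p <= 1 := invr_predn_le1 l2.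
have -> : d%:R ^+ k / (expR 1 * d%:R ^+ l.-1 * k%:R) = d%:R ^+ (k - l).+1 / (expR 1 * k%:R) :> R.
  have -> : d%:R ^+ k = d%:R ^+ l.-1 * d%:R ^+ (k - l).+1 :> R.
    by rewrite -exprD; congr (_ ^+ _); lia.
  field; rewrite ?lt0r_neq0 ?exprn_gt0 ?expR_gt0 //.
set D := _ / _.
have D0 : 0 < D by rewrite divr_gt0 ?exprn_gt0 ?mulr_gt0 ?expR_gt0.
(* The summand + 1 in the statement, needed because m is an integer, comes
   from d ^ k <= #|F| for small D and from the factor h + 1 for large D. *)
have [Dk|kD] := ltP D k%:R.
  apply: (@le_trans _ _ (d ^ k)%N%:R); last first.
    by rewrite ler_nat; apply: unsat_card_ge.
  (* As [p <= 1], the main term is at most [k^-1 k^2 = k]. *)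
  apply: (@le_trans _ _ k.+1%:R); last by rewrite ler_nat ltn_expl.
  rewrite -natr1 lerD2r ler_pdivrMl //.
  apply: (@le_trans _ _ (k%:R `^ (1 + p))).
    by apply: ge0_ler_powR; rewrite ?nnegrE ?addr_ge0 // ltW.
  exact: powR1D_le_sqr.
(* The largest integer threshold with [e k t <= d^(k-l+1)]. *)
pose t := Num.truncn D.
have [tD Dt] : t%:R <= D /\ D < t.+1%:R by apply/andP/truncn_itv/ltW.
have kt : (k <= t)%N by rewrite truncn_ge_nat ?(ltW D0).
have small : expR 1 * (k * t)%:R <= d%:R ^+ (k - l).+1 :> R.
  by move: tD; rewrite ler_pdivlMr ?mulr_gt0 ?expR_gt0 // natrM mulrA mulrC.
have [|h [th hF]] := frequent_variables d0 _ (leq_trans k0 kt) kF lF unF small.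
  by rewrite l2.
have Dp : D `^ p <= h%:R.
  rewrite -[leRHS](powR_root l0) ?ler0n //; apply: ge0_ler_powR => //;
    rewrite ?nnegrE ?exprn_ge0 ?(ltW D0) //.
  by apply/ltW/(lt_le_trans Dt); rewrite -natrX ler_nat.
rewrite -(ler_pM2l kR) mulrDr mulVKf ?lt0r_neq0 // mulr1 powR1D //.
rewrite -natrM; apply: le_trans (_ : (h.+1 * t.+1)%N%:R <= _); last by rewrite ler_nat.
(* The part [h (t + 1)] is at least [D^p D], and the remaining [t + 1] is at least [k]. *)
rewrite mulSn addnC natrD lerD //; last by rewrite ler_nat; apply: leq_trans kt _.
by rewrite natrM mulrC ler_pM ?powR_ge0 ?(ltW D0) ?(ltW Dt).
Qed.

(** * Small unsatisfiable CSPs *)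

(** From [ln (1 - 1/2) <= -1/2]. *)
Lemma ln_ge_half (d : nat) : (2 <= d)%N -> 2^-1 <= ln (d%:R : R).
Proof.
move=> d2; apply: (@le_trans _ _ (ln (2 : R))).
  have := @le_ln1Dx R (- 2^-1); have -> : 1 + - 2^-1 = 2^-1 :> R by field.
  by rewrite lnV ?posrE // lerN2; apply; rewrite ltrN2 invf_lt1 // ltr1n.
by rewrite ler_ln ?posrE ?ltr0n ?ler_nat // ltnW.
Qed.

(** By [1 - d^-k <= expR (- d^-k)], fewer than one assignment survives once [M d^-k > k q ln d]. *)
Lemma few_survivors (d k q M : nat) : (2 <= d)%N ->
    k%:R * q%:R * (ln (d%:R : R) * d%:R ^+ k) < M%:R ->
  (d ^ (k * q) * (d ^ k - 1) ^ M < d ^ (k * M))%N.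
Proof.
move=> d2 HM; have dR : 0 < d%:R :> R by rewrite ltr0n ltnW.
have dk : 0 < d%:R ^+ k :> R by rewrite exprn_gt0.
rewrite -(ltr_nat R) natrM !natrX natrB ?expn_gt0 ?(ltnW d2) // natrX.
have le1 : d%:R ^+ k - 1 <= d%:R ^+ k * expR (- (d%:R ^+ k)^-1) :> R.
  apply: le_trans (ler_wpM2l (ltW dk) (expR_ge1Dx _)).
  by rewrite mulrDr mulr1 mulrN divff ?lt0r_neq0.
apply: (@le_lt_trans _ _ (d%:R ^+ (k * q) * (d%:R ^+ k * expR (- (d%:R ^+ k)^-1)) ^+ M)).
  rewrite ler_wpM2l ?exprn_ge0 ?(ltW dR) //; apply: lerXn2r => //; rewrite nnegrE.
    by rewrite subr_ge0 exprn_ege1 // ler1n ltnW.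
  by rewrite mulr_ge0 ?expR_ge0 // ltW.
rewrite exprMn -exprM mulrCA gtr_pMr ?exprn_gt0 //.
rewrite -{1}[d%:R]lnK ?posrE // -!expRM_natl -expRD -[ltRHS]expR0 ltr_expR.
rewrite mulrN subr_lt0 ltr_pdivlMr //.
by rewrite natrM; move: HM; rewrite !mulrA.
Qed.

Lemma unsat_upper_bound (d l k : nat) :
    (2 <= d)%N -> (2 <= l)%N -> (l <= k)%N ->
  exists M : nat, ~ all_satisfiable l k d M /\
    M%:R <= 4 * expR 1 ^+ 2 *
      ((k%:R ^+ 2 * l%:R^-1 * ln (d%:R : R) * d%:R ^+ k) `^ (1 + (l%:R - 1)^-1)).
Proof.
move=> d2 l2 lk.
have d0 : (0 < d)%N by apply: ltnW.
have dR : 0 < d%:R :> R by rewrite ltr0n.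
have k2 : (2 <= k)%N by apply: leq_trans lk.
have kR : 0 < k%:R :> R by rewrite ltr0n ltnW.
have lR : 0 < l%:R :> R by rewrite ltr0n ltnW.
have l0 : (0 < l.-1)%N by case: l l2 {lk lR} => [|[]].
rewrite natr_predn //; set p := l.-1%:R^-1.
have p0 : 0 <= p by rewrite invr_ge0 ler0n.
have p1 : p <= 1 := invr_predn_le1 l2.
have lp : l%:R * p = 1 + p.
  have -> : l%:R = 1 + l.-1%:R :> R by rewrite addrC natr1 prednK // ltnW.
  by rewrite mulrDl mul1r divff ?pnatr_eq0 -?lt0n // addrC.
pose L : R := ln (d%:R : R) * d%:R ^+ k.
(* This makes [Y] and [Z] below at least 1, so rounding them up at most doubles them. *)
have kL1 : 1 <= k%:R * L.
  have h1 : 2 <= k%:R :> R by rewrite ler_nat.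
  have h2 := ln_ge_half d2.
  have h3 : 1 <= d%:R ^+ k :> R by rewrite exprn_ege1 // ler1n.
  have h4 : 2^-1 <= L by rewrite -[leLHS]mulr1 ler_pM // invr_ge0.
  by rewrite -[leLHS](divff (_ : 2 != 0 :> R)) ?pnatr_eq0 // ler_pM // invr_ge0.
have kL0 : 0 < k%:R * L by apply: lt_le_trans kL1.
have L0 : 0 < L by move: kL0; rewrite pmulr_rgt0.
pose B : R := 'C(k, l)%:R.
have B1 : 1 <= B by rewrite ler1n bin_gt0.
(* Chosen so that [Y^(l-1) = B k L]: then [q > Y] makes the code size, at least [q^l / B], exceed
   [q k L = Z]. *)
pose Y : R := (B * (k%:R * L)) `^ p.
have BkL : 0 < B * (k%:R * L) by rewrite mulr_gt0 // (lt_le_trans ltr01).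
have Y1 : 1 <= Y.
  have -> : 1 = 1 `^ p :> R by rewrite powR1.
  by apply: ge0_ler_powR; rewrite ?nnegrE ?(ltW BkL) // -[leLHS]mulr1 ler_pM.
pose q := (Num.truncn Y).+1.
have Yq : Y < q%:R by apply: truncnS_gt.
have qY : q%:R <= 2 * Y.
  rewrite /q -natr1 (_ : 2 * Y = Y + Y); last by ring.
  by rewrite lerD // truncn_le (le_trans ler01).
pose Z : R := k%:R * q%:R * L.
have Z1 : 1 <= Z.
  by rewrite /Z mulrAC -[leLHS]mulr1 ler_pM // ler1n.
pose M := (Num.truncn Z).+1.
have ZM : Z < M%:R by apply: truncnS_gt.
have MZ : M%:R <= 2 * Z.
  rewrite /M -natr1 (_ : 2 * Z = Z + Z); last by ring.
  by rewrite lerD // truncn_le (le_trans ler01).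
exists M; split.
  have [E [codeE qE]] := @gilbert_varshamov k l q lk isT.
  apply: (unsat_from_code d0 codeE); last exact: few_survivors.
  rewrite truncn_lt_nat ?(le_trans ler01) // -(@ltr_pM2r _ B) ?(lt_le_trans ltr01) //.
  apply: lt_le_trans (_ : (q ^ l)%:R <= _); last by rewrite -natrM ler_nat.
  rewrite natrX -[X in _ ^+ X](ltn_predK l2) exprS.
  rewrite (_ : Z * B = q%:R * (B * (k%:R * L))); last by rewrite /Z; ring.
  rewrite ltr_pM2l ?ltr0n // -[ltLHS](root_powR l0) ?ltW //.
  by rewrite ltr_pXn2r ?nnegrE ?powR_ge0.
apply: le_trans MZ _.
(* Uses [B <= (e k / l)^l] and [l p = 1 + p]. *)
have BY : B `^ p <= (expR 1 * k%:R / l%:R) `^ (1 + p).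
  rewrite -lp powRrM powR_mulrn ?divr_ge0 ?mulr_ge0 ?expR_ge0 ?ler0n //.
  apply: ge0_ler_powR; rewrite ?nnegrE ?ler0n //.
    by rewrite exprn_ge0 ?divr_ge0 ?mulr_ge0 ?expR_ge0 ?ler0n.
  by apply: bin_le_powR; apply: ltnW.
apply: (@le_trans _ _ (4 * ((k%:R * L) * Y))).
  rewrite (_ : 4 * _ = 2 * ((k%:R * L) * (2 * Y))); last by ring.
  by rewrite ler_pM2l // /Z mulrAC ler_pM2l.
rewrite -[leRHS]mulrA ler_pM2l //.
rewrite /Y powRM ?(le_trans ler01) // mulrCA -powR1D //.
apply: (le_trans (ler_wpM2r (powR_ge0 _ _) BY)).
rewrite -powRM ?(ltW kL0) ?divr_ge0 ?mulr_ge0 ?expR_ge0 ?ler0n //.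
rewrite (_ : expR 1 * _ / _ * _ = expR 1 * (k%:R ^+ 2 * l%:R^-1 * ln d%:R * d%:R ^+ k)); last first.
  by rewrite /L; field; rewrite lt0r_neq0.
rewrite powRM ?expR_ge0 //; last first.
  by rewrite -mulrA mulr_ge0 ?(ltW L0) // divr_ge0 ?sqr_ge0 ?(ltW lR).
rewrite ler_wpM2r ?powR_ge0 // powR1D_le_sqr //.
by rewrite -[leLHS]expR0 ler_expR ler01.
Qed.

End Bounds.

(** * Existence of the maximum and both bounds *)

Theorem theorem1 (R : realType) :
  exists c : R, 0 < c /\
    forall d l k : nat, (2 <= d)%N -> (2 <= l)%N -> (l <= k)%N ->
      exists m : nat, is_max_satisfiable l k d m /\
        k%:R^-1 *
          ((d%:R ^+ k / (expR (1 : R) * d%:R ^+ l.-1 * k%:R))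
             `^ (1 + (l%:R - 1)^-1)) <= m%:R :> R /\
        m%:R <
          c * ((k%:R ^+ 2 * l%:R^-1 * ln (d%:R : R) * d%:R ^+ k)
                 `^ (1 + (l%:R - 1)^-1)).
Proof.
(* The 4 comes from rounding up [q] and [M], and [e^2] bounds the [e^(1+p)] of the binomial
   estimate. *)
exists (4 * expR 1 ^+ 2); split; first by rewrite mulr_gt0 ?exprn_gt0 ?expR_gt0.
move=> d l k d2 l2 lk; have [M [unM MB]] := unsat_upper_bound R d2 l2 lk.
have sat0 : exists m, `[< all_satisfiable l k d m >].
  exists 0%N; apply/asboolP => V F _ _; rewrite leqn0 cards_eq0 => /eqP ->.
  exists [ffun => Ordinal (ltnW d2)].
  by apply/forall_inP => C; rewrite inE.
(* [all_satisfiable] is downward closed in its last argument, so failure at [M] caps it at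
   [M - 1]. *)
have satM m : `[< all_satisfiable l k d m >] -> (m <= M.-1)%N.
  move/asboolP => satm; rewrite leqNgt; apply/negP => Mm; apply: unM.
  move=> V F kF lF FM; apply: satm => //; apply: leq_trans FM _.
  by apply: leq_trans Mm; apply: leqSpred.
case: (ex_maxnP sat0 satM) => m /asboolP satm maxm.
have M0 : (0 < M)%N.
  rewrite lt0n; apply/eqP => M0; apply: unM; rewrite M0.
  by case: sat0 satM {maxm satm} => m0 /asboolP sat _ V F kF lF F0;
    apply: sat => //; apply: leq_trans F0 _.
exists m; split; first by split=> // m' sat'; apply/maxm/asboolP.
split; last first.
  apply: lt_le_trans MB; rewrite ltr_nat -(prednK M0) ltnS.
  by apply/satM/asboolP.
have : ~ all_satisfiable l k d m.+1.
  by move=> /asboolP/maxm; rewrite ltnn.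
(* If the bound exceeded [m], an unsatisfiable CSP would have more than [m + 1] constraints, against
   maximality of [m]. *)
move=> unm; rewrite leNgt; apply/negP => lt_m; apply: unm.
move=> V F kF lF Fm; apply: contrapT => unF.
have := unsat_lower_bound R d2 l2 lk kF lF unF.
apply/negP; rewrite -ltNge; apply: le_lt_trans (_ : m.+1%:R < _).
  by rewrite ler_nat.
by rewrite -natr1 ltrD2r.
Qed.
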